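(* Let $Q$ be a network and $\alpha>0$. Let $S:[0,L]\to Q$ be a closed unit speed path visiting every point of $Q$ such that every point $x\in Q$ is visited by $S$ at $k$ times $t_1,\dots,t_k\in[0,L)$ that are pairwise separated by at least $\alpha$ modulo $L$. Let $\tilde S$ be the randomized periodic extension of $S$. Then: (i) $\tilde S$ intercepts any attack with probability at least $k\alpha/L$; (ii) if $L=k\mu$, then $\tilde S$ (for the Patroller) and any uniform attack strategy (for the Attacker) are optimal, and $V=\alpha/\mu$.
   Context: A network $Q$ is a finite connected graph, possibly with multiple arcs and loops and with no degree-two nodes, and it is not a line segment. Arcs are open intervals of positive length. $\lambda$ is the length measure, $\mu=\lambda(Q)$, and $d$ is the shortest-path metric. A path is unit speed if it is $1$-Lipschitz with respect to $d$. The game is as follows. The Patroller picks a patrol $S:[0,\infty)\to Q$ with $d(S(t),S(t'))\le|t-t'|$. The Attacker picks $x\in Q$ and $\tau\ge0$, and the attack is intercepted iff $x\in S([\tau,\tau+\alpha])$. $V$ is the value (optimal interception probability) with mixed strategies. ''Separated by at least $\alpha$ modulo $L$'' means $\min(|t_i-t_j|,L-|t_i-t_j|)\ge\alpha$ for $i\ne j$. The randomized periodic extension $\tilde S$ of $S$ is the mixed patrol $t\mapsto S((t+\Delta)\bmod L)$ with $\Delta$ uniform on $[0,L]$. A uniform attack strategy fixes $M\ge0$, attacks during $[M,M+\alpha]$, and chooses the point with distribution $\lambda/\mu$.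
   Formalization: For k=1 the assumption α ≤ L is added: pairwise separation is then vacuous, and for α > L the claims would give an interception probability or value above 1; for k ≥ 2 it follows from the separation. *)

(* Defs.v *)
From HB Require Import structures.
From mathcomp Require Import all_boot all_order all_algebra.
From mathcomp Require Import all_classical all_reals all_analysis.
From mathcomp Require Import lra.
Import Order.TTheory GRing.Theory Num.Theory numFieldNormedType.Exports.

Set Implicit Arguments.
Unset Strict Implicit.
Unset Printing Implicit Defensive.

Local Open Scope classical_set_scope.
Local Open Scope ring_scope.

Ltac split_minmax :=
  let inner a b :=
    lazymatch constr:((a, b)) with
    | context [Order.min _ _] => fail
    | context [Order.max _ _] => fail
    | _ => case: (leP a b) => ?
    end in
  repeat match goal with
  | |- context [Order.min ?a ?b] => inner a b
  | |- context [Order.max ?a ?b] => inner a b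
  end.

(* Each arc carries an arbitrary orientation, used only to parametrize it by
   arc length.  Loops ([tail e = head e]) and parallel arcs are allowed; a loop
   counts twice in the degree.  In the absence of degree-two nodes the network
   is a line segment iff it has a single arc and this arc is not a loop. *)
Record network (R : realType) := Network {
  node : finType;
  arc : finType;
  tail : arc -> node;
  head : arc -> node;
  len : arc -> R;
  len_gt0 : forall e, 0 < len e;
  node_gt0 : (0 < #|node|)%N;
  network_connected : forall v w : node,
    connect (fun a b => [exists e, ((tail e == a) && (head e == b))
                                || ((tail e == b) && (head e == a))]) v w;
  no_degree_two : forall v : node,
    (#|[set e | tail e == v]%SET| + #|[set e | head e == v]%SET|)%N <> 2%N;
  not_segment : ~ exists e : arc, (forall e' : arc, e' = e) /\ tail e <> head e }.

Section points.
Context {R : realType} (Q : network R).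

(* [inl v] is a node; [inr (e, s)] is the point of the open arc [e] at
   distance [s] from its tail along [e]. *)
Definition npoint : Type :=
  (node Q + {p : arc Q * R | 0 < p.2 < len p.1})%type.

HB.instance Definition _ := Choice.on npoint.
HB.instance Definition _ :=
  isPointed.Build npoint (inl (enum_val (Ordinal (node_gt0 Q)))).

(* arc-length parametrization of the closure of [e], constant outside
   [[0, len e]] *)
Definition chart (e : arc Q) (s : R) : npoint :=
  match insub (e, s) with
  | Some p => inr p
  | None => inl (if s <= 0 then tail e else head e)
  end.

(* A walk is a list of steps [(e, a, b)], each going from [chart e a] to
   [chart e b] inside the closure of the arc [e]. *)
Fixpoint is_walk (x : npoint) (w : seq (arc Q * R * R)) (y : npoint) : Prop :=
  match w with
  | [::] => x = y
  | (e, a, b) :: w' => [/\ 0 <= a <= len e, 0 <= b <= len e,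
                          x = chart e a & is_walk (chart e b) w' y]
  end.

Definition walk_length (w : seq (arc Q * R * R)) : R :=
  \sum_(p <- w) `|p.1.2 - p.2|.

Definition dist (x y : npoint) : R :=
  inf [set walk_length w | w in [set w | is_walk x w y]].

Lemma chart_in e s (es : 0 < (e, s).2 < len (e, s).1) :
  chart e s = inr (exist _ (e, s) es).
Proof.
rewrite /chart; case: insubP => [u _ uE|]; last by rewrite es.
by congr inr; exact: val_inj.
Qed.

Lemma chart_tail e s : s <= 0 -> chart e s = inl (tail e).
Proof.
by move=> s0; rewrite /chart insubN /= ?s0// negb_and -!leNgt s0.
Qed.

Lemma chart_head e s : len e <= s -> chart e s = inl (head e).
Proof.
move=> ls; have s0 := lt_le_trans (len_gt0 e) ls.
by rewrite /chart insubN /= ?[s <= 0]leNgt ?s0// negb_and -!leNgt ls orbT.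
Qed.

Lemma chart_val (p : {p : arc Q * R | 0 < p.2 < len p.1}) :
  chart (val p).1 (val p).2 = inr p.
Proof. by case: p => [[e s] es] /=; rewrite (chart_in es). Qed.

Lemma walk_length_ge0 w : 0 <= walk_length w.
Proof. by apply: sumr_ge0. Qed.

Lemma walk_cat x w y w' z :
  is_walk x w y -> is_walk y w' z -> is_walk x (w ++ w') z.
Proof.
elim: w x => [|[[e a] b] w IH] x /=; first by move=> ->.
by case=> ? ? ? /IH{}IH /IH.
Qed.

Lemma walk_length_cat w w' :
  walk_length (w ++ w') = walk_length w + walk_length w'.
Proof. by rewrite /walk_length big_cat. Qed.

Lemma walk_rev x w y : is_walk x w y ->
  exists2 w', is_walk y w' x & walk_length w' = walk_length w.
Proof.
elim: w x => [|[[e a] b] w IH] x /=; first by move=> ->; exists [::].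
case=> ha hb -> /IH[w' w'y w'E]; exists (w' ++ [:: (e, b, a)]).
  by apply: walk_cat w'y _; split.
rewrite walk_length_cat w'E /walk_length !big_cons big_nil addr0 addrC /=.
by rewrite distrC.
Qed.

Lemma walk_ex x y : exists w, is_walk x w y.
Proof.
have to_node z : exists v w, is_walk z w (inl v).
  case: z => [v|p]; first by exists v, [::].
  exists (tail (val p).1), [:: ((val p).1, (val p).2, 0)] => /=.
  have := len_gt0 (val p).1; have /andP[p0 pl] := valP p => l0.
  by split; rewrite ?chart_val ?chart_tail// ?lexx ?ltW.
have nodes v w : exists s, is_walk (inl v) s (inl w).
  have /connectP[s] := network_connected v w.
  elim: s v => [|u s IH] v /=; first by move=> _ ->; exists [::].
  case/andP=> /existsP[e e_uv] /IH{}IH /IH[w' uw].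
  have l0 := len_gt0 e.
  case/orP: e_uv => /andP[/eqP eu /eqP ev].
    exists ((e, 0, len e) :: w'); split; rewrite ?lexx ?ltW//.
      by rewrite chart_tail ?eu.
    by rewrite chart_head ?ev.
  exists ((e, len e, 0) :: w'); split; rewrite ?lexx ?ltW//.
    by rewrite chart_head ?ev.
  by rewrite chart_tail ?eu.
have [v [w1 xv]] := to_node x; have [u [w2 yu]] := to_node y.
have [w3 vu] := nodes v u; have [w4 uy _] := walk_rev yu.
by exists (w1 ++ (w3 ++ w4)); apply: walk_cat xv (walk_cat vu uy).
Qed.

Lemma dist_le x w y : is_walk x w y -> dist x y <= walk_length w.
Proof.
move=> xy; apply: ge_inf; last by exists w.
by exists 0 => _ [w' _ <-]; exact: walk_length_ge0.
Qed.

Lemma dist_lb x y c :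
  (forall w, is_walk x w y -> c <= walk_length w) -> c <= dist x y.
Proof.
move=> h; apply: lb_le_inf; last by move=> _ [w' xy <-]; exact: h.
by have [w xy] := walk_ex x y; exists (walk_length w), w.
Qed.

Lemma dist_ge0 x y : 0 <= dist x y.
Proof. by apply: dist_lb => w _; exact: walk_length_ge0. Qed.

Lemma distxx x : dist x x = 0.
Proof.
apply/eqP; rewrite eq_le dist_ge0 andbT.
by rewrite (le_trans (@dist_le x [::] x erefl))// /walk_length big_nil.
Qed.

Lemma dist_sym x y : dist x y = dist y x.
Proof.
suff h x' y' : dist x' y' <= dist y' x' by apply/eqP; rewrite eq_le !h.
by apply: dist_lb => w /walk_rev[w' w'y <-]; exact: dist_le.
Qed.

Lemma dist_triangle y x z : dist x z <= dist x y + dist y z.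
Proof.
rewrite -lerBlDr; apply: dist_lb => w1 xy.
rewrite lerBlDr addrC -lerBlDr; apply: dist_lb => w2 yz.
by rewrite lerBlDr addrC -walk_length_cat; exact: dist_le (walk_cat xy yz).
Qed.

Lemma dist_potential (f : npoint -> R) :
  (forall e a b, 0 <= a <= len e -> 0 <= b <= len e ->
     f (chart e b) - f (chart e a) <= `|a - b|) ->
  forall x y, f y - f x <= dist x y.
Proof.
move=> fL x y; apply: dist_lb => w.
elim: w x => [|[[e a] b] w IH] x /=.
  by move=> ->; rewrite /walk_length big_nil subrr.
case=> ha hb -> /IH; rewrite /walk_length big_cons /= => h.
by have := fL e a b ha hb; lra.
Qed.

Lemma min_nonexpansive (x y x' y' k : R) : x - x' <= k -> y - y' <= k ->
  Num.min x y - Num.min x' y' <= k.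
Proof. by move=> ? ?; split_minmax; lra. Qed.

Lemma min_len : exists2 m, 0 < m & forall e : arc Q, m <= len e.
Proof.
exists (\big[Num.min/1]_(e : arc Q) len e); last by move=> e; exact: bigmin_le_cond.
by apply/bigmin_gtP; split => // e _; exact: len_gt0.
Qed.

Lemma dist_positivity x y : dist x y = 0 -> x = y.
Proof.
suff [f [fL fx fy]] : exists f : npoint -> R,
    [/\ (forall e a b, 0 <= a <= len e -> 0 <= b <= len e ->
           f (chart e b) - f (chart e a) <= `|a - b|),
        f x = 0 & forall y, f y <= 0 -> x = y].
  move=> xy0; apply: fy; have := dist_potential fL x y.
  by rewrite xy0 fx subr0.
have endpoints e s : 0 <= s <= len e ->
    [\/ s = 0, s = len e | 0 < s < len e].
  case/andP; rewrite le_eqVlt => /orP[/eqP <-|s0]; first by constructor 1.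
  rewrite le_eqVlt => /orP[/eqP <-|s1]; first by constructor 2.
  by constructor 3; rewrite s0.
case: x => [v|[[e0 s0] p0]].
  have [m m0 mle] := min_len.
  pose G (e : arc Q) (s : R) : R := Num.min m
    (Num.min (if tail e == v then s else m)
             (if head e == v then len e - s else m)).
  pose f (z : npoint) : R := match z with
    | inl w => if w == v then 0 else m
    | inr p => G (val p).1 (val p).2 end.
  have fE e s : 0 <= s <= len e -> f (chart e s) = G e s.
    have l0 := len_gt0 e; have ml := mle e.
    case/endpoints => [->|->|es].
    - rewrite chart_tail// /= /G; set X := (if head e == v then _ else _).
      have mX : m <= X by rewrite /X subr0; case: ifP.
      case: ifP => _; last by rewrite (min_l mX) minxx.
      by rewrite (min_l (le_trans (ltW m0) mX)) (min_r (ltW m0)).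
    - rewrite chart_head// /= /G subrr; set X := (if tail e == v then _ else _).
      have mX : m <= X by rewrite /X; case: ifP.
      case: ifP => _; last by rewrite (min_r mX) minxx.
      by rewrite (min_r (le_trans (ltW m0) mX)) (min_r (ltW m0)).
    - by rewrite (@chart_in e s es).
  exists f; split.
  - move=> e a b ha hb; rewrite !fE// /G.
    have := ler_norm (a - b); have := ler_norm (b - a); rewrite (distrC b a).
    move=> h1 h2; have h0 := normr_ge0 (a - b).
    apply: min_nonexpansive; first by lra.
    by apply: min_nonexpansive; case: ifP => _; lra.
  - by rewrite /= eqxx.
  - case=> [w|[[e s] p]] /= le0; first by move: le0; case: eqP => [->//|_]; rewrite leNgt m0.
    exfalso; move: (p) => /andP[/= s0 sl]; move: le0.
    rewrite leNgt /G !lt_min m0 /=.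
    by case: ifP => _; case: ifP => _; rewrite ?s0 ?subr_gt0 ?sl ?m0.
have /andP[/= s00 s0l] := p0.
pose r := Num.min s0 (len e0 - s0).
have r0 : 0 < r by rewrite lt_min s00 subr_gt0.
have rs : r <= s0 by rewrite ge_min lexx.
have rl : r <= len e0 - s0 by rewrite ge_min lexx orbT.
pose G (e : arc Q) (s : R) : R := if e == e0 then Num.min r `|s - s0| else r.
pose f (z : npoint) : R := match z with
  | inl w => r
  | inr p => G (val p).1 (val p).2 end.
have fE e s : 0 <= s <= len e -> f (chart e s) = G e s.
  case/endpoints => [->|->|es].
  - rewrite chart_tail// /= /G; case: eqP => // _; apply/esym/min_idPl.
    by rewrite sub0r normrN gtr0_norm.
  - rewrite chart_head// /= /G; case: eqP => // ->; apply/esym/min_idPl.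
    by rewrite gtr0_norm// subr_gt0.
  - by rewrite (@chart_in e s es).
exists f; split.
- move=> e a b ha hb; rewrite !fE// /G; case: eqP => // _; last by rewrite subrr.
  have := ler_distD a b s0; rewrite (distrC b a).
  by move=> h; apply: min_nonexpansive; rewrite ?subrr// lerBlDr.
- by rewrite /= /G eqxx subrr normr0; apply/min_idPr; exact: ltW.
- case=> [w|[[e s] p]] /=; first by rewrite leNgt r0.
  rewrite /G; case: eqP => [?|_]; last by rewrite leNgt r0.
  subst e; rewrite ge_min leNgt r0 /= normr_le0 subr_eq0 => /eqP ?; subst s.
  by congr inr; exact: val_inj.
Qed.

HB.instance Definition _ := isMetric.Build R npoint
  distxx dist_positivity dist_sym dist_triangle.

(* Borel sigma-algebra of the metric space [npoint] *)
HB.instance Definition _ := @isMeasurable.Build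
  (sigma_display (@open npoint)) npoint <<s @open npoint >>
  (@sigma_algebra0 _ setT _) (@sigma_algebraC _ _)
  (@sigma_algebra_bigcup _ setT _).

Lemma chart_lipschitz (e : arc Q) (a b : R) :
  mdist (chart e a) (chart e b) <= `|a - b|.
Proof.
have l0 := len_gt0 e.
pose c (s : R) : R := Num.min (len e) (Num.max 0 s).
have cE s : chart e s = chart e (c s).
  rewrite /c; case: (leP s 0) => s0.
    by rewrite (min_idPr (ltW l0)) !chart_tail.
  case: (leP (len e) s) => // sl.
  by rewrite !chart_head.
have c01 s : 0 <= c s <= len e.
  by rewrite /c le_min ge_min ltW//= lexx le_max lexx.
rewrite (cE a) (cE b); apply: (@le_trans _ _ `|c a - c b|).
  have := @dist_le (chart e (c a)) [:: (e, c a, c b)] (chart e (c b)).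
  by rewrite /walk_length big_seq1; apply; split.
rewrite ler_norml; have := ler_norm (a - b); have := ler_norm (b - a).
rewrite (distrC b a) => h1 h2.
by rewrite /c; apply/andP; split; split_minmax; lra.
Qed.

Lemma lipschitz_measurable (f : R -> npoint) :
  (forall a b, mdist (f a) (f b) <= `|a - b|) ->
  measurable_fun [set: R] f.
Proof.
move=> fL; apply: (@measurability _ _ _ _ setT f (@open npoint)) => //.
move=> _ [U oU <-]; rewrite setTI; apply: (@measurable_realfun.open_measurable R).
rewrite openE => x /= Ufx.
have /nbhs_ballP[e /= e0 eU] : nbhs (f x) U by exact: open_nbhs_nbhs.
apply/nbhs_ballP; exists e => // y xy; apply: eU.
by rewrite ballEmdist /= (le_lt_trans (fL _ _)).
Qed.

Lemma measurable_chart e : measurable_fun [set: R] (chart e).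
Proof. by apply: lipschitz_measurable => a b; exact: chart_lipschitz. Qed.

End points.

Section length_measure.
Context {R : realType} (Q : network R).
Local Open Scope ereal_scope.

Definition length_measure (B : set (npoint Q)) : \bar R :=
  \sum_(e : arc Q) lebesgue_measure (`]0%R, len e[%classic `&` chart e @^-1` B).

Let length0 : length_measure set0 = 0.
Proof.
by rewrite /length_measure big1// => e _; rewrite preimage_set0 setI0 measure0.
Qed.

Let length_ge0 B : 0 <= length_measure B.
Proof. by apply: sume_ge0 => e _; exact: measure_ge0. Qed.

Let length_sigma_additive : semi_sigma_additive length_measure.
Proof.
move=> F mF tF mUF; rewrite /length_measure.
under eq_fun do rewrite exchange_big.
apply: cvg_nnesum => e _; first by near=> n; exact: sume_ge0.
rewrite preimage_bigcup setI_bigcupr.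
have mFe i : measurable (`]0%R, len e[%classic `&` chart e @^-1` F i).
  apply: measurableI => //; rewrite -[X in measurable X]setTI.
  exact: measurable_chart.
apply: measure_semi_sigma_additive => //; last first.
  by apply: bigcup_measurable => i _; exact: mFe.
apply/trivIsetP => i j _ _ ij.
move/trivIsetP : tF => /(_ i j Logic.I Logic.I ij) Fij.
by rewrite setIACA setIid -preimage_setI Fij preimage_set0 setI0.
Unshelve. all: by end_near. Qed.

HB.instance Definition _ := isMeasure.Build _ _ _ length_measure
  length0 length_ge0 length_sigma_additive.

Definition total_length : R := fine (length_measure [set: npoint Q]).

End length_measure.

Section game.
Context {R : realType} (Q : network R).

Record patrol := Patrol {
  patrol_fun :> {nonneg R} -> npoint Q ;
  patrol_unit_speed : forall t u : {nonneg R},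
    mdist (patrol_fun t) (patrol_fun u) <= `|t%:num - u%:num| }.

Lemma const_unit_speed (t u : {nonneg R}) :
  mdist (point : npoint Q) point <= `|t%:num - u%:num|.
Proof. by rewrite mdistxx. Qed.

HB.instance Definition _ := gen_eqMixin patrol.
HB.instance Definition _ := gen_choiceMixin patrol.
HB.instance Definition _ := isPointed.Build patrol (Patrol const_unit_speed).

(* The space of patrols carries the sigma-algebra generated by the evaluation
   maps, i.e. the Borel sigma-algebra of uniform convergence on compact sets. *)
Definition cylinders : set_system patrol :=
  [set C | exists t : {nonneg R}, exists2 B : set (npoint Q),
     measurable B & C = [set S : patrol | B (S t)]].

HB.instance Definition _ := @isMeasurable.Build
  (sigma_display cylinders) patrol <<s cylinders >>
  (@sigma_algebra0 _ setT _) (@sigma_algebraC _ _)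
  (@sigma_algebra_bigcup _ setT _).

(* The pair [(x, tau)] stands for the attack at [x] during
   [[tau, tau + alpha]]. *)
Definition intercepts (alpha : R) (S : patrol) (a : npoint Q * R) : Prop :=
  exists2 t : {nonneg R}, a.2 <= t%:num <= a.2 + alpha & S t = a.1.

Definition mixed_attacks : set (probability (npoint Q * R)%type R) :=
  [set A | A ([set: npoint Q] `*` `[0, +oo[) = 1%E].

(* interception probability when the patrol and the attack are drawn
   independently from [P] and [A] *)
Definition payoff (alpha : R) (P : probability patrol R)
    (A : probability (npoint Q * R)%type R) : \bar R :=
  (P \x A)%E [set u | intercepts alpha u.1 u.2].

Definition patroller_guarantee (alpha : R) (P : probability patrol R) :=
  ereal_inf [set payoff alpha P A | A in mixed_attacks].

Definition attacker_guarantee (alpha : R)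
    (A : probability (npoint Q * R)%type R) :=
  ereal_sup [set payoff alpha P A | P in [set: probability patrol R]].

Definition lower_value (alpha : R) : \bar R :=
  ereal_sup [set patroller_guarantee alpha P | P in [set: probability patrol R]].

Definition upper_value (alpha : R) : \bar R :=
  ereal_inf [set attacker_guarantee alpha A | A in mixed_attacks].

Definition is_value (alpha : R) (v : \bar R) : Prop :=
  lower_value alpha = v /\ upper_value alpha = v.

Definition optimal_patrol (alpha : R) (P : probability patrol R) : Prop :=
  patroller_guarantee alpha P = lower_value alpha.

Definition optimal_attack (alpha : R)
    (A : probability (npoint Q * R)%type R) : Prop :=
  mixed_attacks A /\ attacker_guarantee alpha A = upper_value alpha.

(* The fallback [\d_point] of [mnormalize] only matters for the network
   without arcs, whose total length is zero. *)
Definition uniform_attack (M : R) : probability (npoint Q * R)%type R :=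
  (mnormalize (@length_measure R Q) \d_(point : npoint Q) \x \d_M)%E.

End game.

Section periodic_extension.
Context {R : realType} (Q : network R) (L : R).

Record closed_path := ClosedPath {
  path_fun :> R -> npoint Q ;
  path_unit_speed : forall t u, 0 <= t <= L -> 0 <= u <= L ->
    mdist (path_fun t) (path_fun u) <= `|t - u| ;
  path_closed : path_fun 0 = path_fun L }.

(* representative of [t] modulo [L] in [[0, L[] *)
Definition modr (t : R) : R := t - (Num.floor (t / L))%:~R * L.

Variables (S : closed_path) (L_gt0 : 0 < L).

Lemma modr_itv t : 0 <= modr t < L.
Proof.
have /andP[h1 h2] := floor_itv (t / L); move: h1 h2.
rewrite /modr intrD ler_pdivlMr// ltr_pdivrMr// mulrDl mul1r => h1 h2.
by rewrite subr_ge0 h1 /= ltrBlDr addrC.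
Qed.

Lemma periodic_unit_speed t u :
  mdist (S (modr t)) (S (modr u)) <= `|t - u|.
Proof.
wlog tu : t u / t <= u.
  move=> h; have [/h//|/ltW /h] := leP t u.
  by rewrite metric_sym distrC.
have /andP[t0 tL] := modr_itv t; have /andP[u0 uL] := modr_itv u.
rewrite (distrC t u) (ger0_norm (_ : 0 <= u - t)) ?subr_ge0//.
have : (Num.floor (t / L) <= Num.floor (u / L))%R.
  by apply: le_floor; rewrite ler_pM2r ?invr_gt0.
rewrite le_eqVlt => /orP[/eqP tu_floor|].
  have -> : u - t = `|modr t - modr u|.
    rewrite distrC ger0_norm /modr tu_floor; last by lra.
    lra.
  by apply: path_unit_speed; rewrite ?t0 ?u0 ?(ltW tL) ?(ltW uL).
rewrite -lezD1 -(ler_int R) intrD => tu_floor.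
have {}tu_floor := ler_wpM2r (ltW L_gt0) tu_floor.
rewrite mulrDl mul1r in tu_floor.
have tE : t = modr t + (Num.floor (t / L))%:~R * L by rewrite /modr subrK.
have uE : u = modr u + (Num.floor (u / L))%:~R * L by rewrite /modr subrK.
apply: (le_trans (metric_triangle _ (S L) _)).
have h1 : mdist (S (modr t)) (S L) <= L - modr t.
  have Lt : 0 <= L - modr t by lra.
  rewrite -(ger0_norm Lt) distrC.
  by apply: path_unit_speed; apply/andP; split; lra.
have h2 : mdist (S L) (S (modr u)) <= modr u.
  rewrite -path_closed -[leRHS](ger0_norm u0) -[in leRHS](subr0 (modr u)).
  by rewrite distrC; apply: path_unit_speed; apply/andP; split; lra.
lra.
Qed.

Lemma shift_unit_speed (D : R) (t u : {nonneg R}) :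
  mdist (S (modr (t%:num + D))) (S (modr (u%:num + D))) <=
    `|t%:num - u%:num|.
Proof.
apply: (le_trans (periodic_unit_speed _ _)).
by rewrite opprD addrACA subrr addr0.
Qed.

Definition shift (D : measurableTypeR R) : patrol Q :=
  Patrol (shift_unit_speed D).

Lemma measurable_shift : measurable_fun [set: measurableTypeR R] shift.
Proof.
apply: (@measurability _ _ _ _ setT shift (@cylinders R Q)) => //.
move=> _ [_ [t [B mB ->]] <-].
rewrite (_ : shift @^-1` _ = (fun D => S (modr (t%:num + D))) @^-1` B)//.
apply: lipschitz_measurable => // a b.
apply: (le_trans (periodic_unit_speed _ _)).
by rewrite opprD addrACA subrr add0r.
Qed.

HB.instance Definition _ :=
  isMeasurableFun.Build _ _ (measurableTypeR R) (patrol Q) shift measurable_shift.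

Definition randomized_extension : probability (patrol Q) R :=
  distribution (uniform_prob L_gt0) shift.

End periodic_extension.

(* Main.v *)
(* Lower bound: the visits of [S] to [x] are [alpha]-separated modulo [L], so the
   [k] sets of shifts [Delta] for which they fall in a given attack interval are
   disjoint arcs of length [alpha] of the circle of length [L].  Upper bound: a
   unit speed path covers a length at most [alpha] during [[M, M + alpha]].
   Fubini's theorem turns these pointwise bounds into bounds on the payoffs; it
   needs the joint measurability of interception, which comes from compactness
   of the attack interval and separability of the network. *)
Require Import Defs.
From mathcomp Require Import all_boot all_order all_algebra.
From mathcomp Require Import all_classical all_reals all_analysis.
From mathcomp Require Import measurable_realfun lra.
Import Order.TTheory GRing.Theory Num.Theory numFieldNormedType.Exports.

Set Implicit Arguments.
Unset Strict Implicit.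
Unset Printing Implicit Defensive.

Local Open Scope classical_set_scope.
Local Open Scope ring_scope.

(** * Approximation and continuity on the real line *)

Section reals.
Context {R : realType}.

(** Extends time to the whole line: for a patrol [S], the map sending [t] to [S (abs_nng t)] is
    1-Lipschitz on [R], so that real analysis applies to it. *)
Definition abs_nng (t : R) : {nonneg R} := NngNum (normr_ge0 t).

Lemma abs_sub_lt (L a b : R) : 0 <= a < L -> 0 <= b < L -> `|a - b| < L.
Proof.
by move=> /andP[? ?] /andP[? ?]; rewrite ltr_norml; apply/andP; split; lra.
Qed.

Lemma natSinv_lt (e : R) : 0 < e -> exists n : nat, n.+1%:R^-1 < e.
Proof.
move=> e0; have [n _ /(_ n (leqnn n))] := near_infty_natSinv_lt (PosNum e0).
by exists n.
Qed.

Lemma rat_dist_lt (x e : R) : 0 < e -> exists q : rat, x <= ratr q < x + e.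
Proof.
move=> e0; have /rat_in_itvoo[q] : x < x + e by rewrite ltrDl.
by rewrite in_itv /= => /andP[/ltW ? ?]; exists q; apply/andP.
Qed.

Lemma lipschitz_within_continuous (f : R -> R) (c : R) (A : set R) :
  (forall a b, `|f a - f b| <= c * `|a - b|) -> {within A, continuous f}.
Proof.
move=> fL; apply: continuous_subspaceT => x; apply/cvgrPdist_lt => e e0.
(* [c] may be [0], so a strictly positive constant is needed to divide by. *)
have c1 : 0 < `|c| + 1 by rewrite ltr_pwDr.
near=> y; rewrite (le_lt_trans (fL _ _))//.
rewrite (@le_lt_trans _ _ ((`|c| + 1) * `|x - y|))//.
  by rewrite ler_wpM2r// (le_trans (ler_norm c))// lerDl.
rewrite mulrC -ltr_pdivlMr//; near: y.
by apply/nbhs_ballP; exists (e / (`|c| + 1)); [rewrite /= divr_gt0|].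
Unshelve. all: by end_near. Qed.

End reals.

(** * Measurability of the interception event *)

Section intercept_measurable.
Context {R : realType} (Q : network R).

Lemma open_mdist_lt (z : npoint Q) (e : R) : open [set y | mdist y z < e].
Proof.
rewrite openE => y /= yz; apply/nbhs_ballP.
exists (e - mdist y z); first by rewrite /= subr_gt0.
move=> w; rewrite ballEmdist /= => yw.
by rewrite (le_lt_trans (metric_triangle _ y _))// (metric_sym w) -ltrBrDr.
Qed.

Lemma measurable_mdist_lt (z : npoint Q) (e : R) :
  measurable [set y | mdist y z < e].
Proof. by apply: sub_sigma_algebra; exact: open_mdist_lt. Qed.

Lemma measurable_eval (t : {nonneg R}) :
  measurable_fun [set: patrol Q] (fun S => S t).
Proof.
move=> _ B mB; rewrite setTI; apply: sub_sigma_algebra.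
by exists t, B.
Qed.

(* Compactness: the distance to [x] plus the distance to the attack interval
   attains its minimum, which is [0] if approximate interceptions exist. *)
Lemma intercepts_approx (alpha : R) (S : patrol Q) (x : npoint Q) (tau : R) :
  0 <= alpha ->
  (forall n : nat, exists2 q : {nonneg R},
     tau - n.+1%:R^-1 <= q%:num <= tau + alpha + n.+1%:R^-1 &
     mdist (S q) x <= n.+1%:R^-1) ->
  intercepts alpha S (x, tau).
Proof.
move=> alpha0 H.
pose h (t : R) := mdist (S (abs_nng t)) x
  + (Num.max 0 (tau - t) + Num.max 0 (t - (tau + alpha))).
(* The constant is [3] because each of the three terms of [h] is 1-Lipschitz. *)
have hL a b : `|h a - h b| <= 3 * `|a - b|.
  have k1 : `|mdist (S (abs_nng a)) x - mdist (S (abs_nng b)) x| <= `|a - b|.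
    have l1 := patrol_unit_speed S (abs_nng a) (abs_nng b).
    have l2 := metric_triangle (S (abs_nng a)) (S (abs_nng b)) x.
    have l3 := metric_triangle (S (abs_nng b)) (S (abs_nng a)) x.
    have l4 := metric_sym (S (abs_nng a)) (S (abs_nng b)).
    have l5 := ler_dist_dist a b.
    by rewrite /= in l1; rewrite ler_norml; apply/andP; split; lra.
  rewrite /h; have := ler_norm (a - b); have := ler_norm (b - a).
  rewrite (distrC b a); move: k1; rewrite !ler_norml => /andP[? ?] ? ?.
  by apply/andP; split; split_minmax; lra.
have n1 : (1%:R^-1 : R) = 1 by rewrite invr1.
(* Since [n.+1%:R^-1 <= 1], this compact interval contains all approximate interception times; the
   one for [n = 0] shows that it is nonempty. *)
pose a : R := Num.max 0 (tau - 1); pose b : R := tau + alpha + 1.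
have [q0 q0b _] := H 0%N; rewrite n1 in q0b.
have q0ge : 0 <= q0%:num by [].
have ab : a <= b by rewrite /a /b; split_minmax; lra.
have hC : {within `[a, b], continuous h} by apply: lipschitz_within_continuous hL.
have [c] := EVT_min ab hC.
rewrite in_itv /= => /andP[ac cb] cmin.
have c0 : 0 <= c by apply: le_trans ac; rewrite le_max lexx.
have hc : h c <= 0.
  apply/ler_addgt0Pr => e e0; rewrite add0r.
  (* At the time [q] supplied by [H n], each of the three terms of [h] is at most [n.+1%:R^-1],
     hence the choice of [e / 3]. *)
  have [n ne] := @natSinv_lt R (e / 3) (divr_gt0 e0 (ltr0Sn _ _)).
  have n0 : (n.+1%:R^-1 : R) <= 1 by rewrite invf_le1// ler1n.
  have [q qb qx] := H n; have qge : 0 <= q%:num by [].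
  set v : R := n.+1%:R^-1 in ne n0 qb qx.
  apply: (le_trans (cmin q%:num _)).
    by rewrite in_itv /= /a /b ge_max qge /=; apply/andP; split; lra.
  have qE : abs_nng q%:num = q by apply/val_inj; rewrite /= ger0_norm.
  by rewrite /h qE; split_minmax; lra.
(* All terms of [h c] are nonnegative and their sum is at most [0], so each vanishes: [c] is an
   exact interception time. *)
have d0 : 0 <= mdist (S (abs_nng c)) x by exact: mdist_ge0.
exists (abs_nng c) => /=.
  rewrite ger0_norm//; apply/andP; split; move: hc; rewrite /h; split_minmax; lra.
apply/mdist_positivity/eqP; rewrite eq_le d0 andbT.
by move: hc; rewrite /h; split_minmax; lra.
Qed.

(* The image of the rationals under [g] is dense, so an interception is an
   event involving countably many evaluations. *)
Lemma measurable_intercepts (g : R -> npoint Q) (alpha : R) : 0 <= alpha ->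
  (forall a b, mdist (g a) (g b) <= `|a - b|) -> (forall x, exists u, g u = x) ->
  measurable [set u : patrol Q * (npoint Q * R) | intercepts alpha u.1 u.2].
Proof.
move=> alpha0 gL gonto.
pose N (q : rat) : {nonneg R} := abs_nng (ratr q).
(* The patrol and the attacked point are both compared with [g (ratr r)]; two errors [e n] add up to
   the tolerance of [intercepts_approx]. *)
pose e n : R := n.+1%:R^-1 / 2.
have e0 n : 0 < e n by rewrite divr_gt0.
have ee n : n.+1%:R^-1 = e n + e n by rewrite /e -splitr.
have -> : [set u : patrol Q * (npoint Q * R) | intercepts alpha u.1 u.2] =
  \bigcap_n \bigcup_(p : rat * rat)
  [set u : patrol Q * (npoint Q * R) | mdist (u.1 (N p.1)) (g (ratr p.2)) < e n
   /\ mdist u.2.1 (g (ratr p.2)) < e n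
   /\ u.2.2 \in `[(N p.1)%:num - alpha - e n, (N p.1)%:num + e n]].
  apply/seteqP; split => [[S [x tau]] [/= t tI Stx] n _|[S [x tau]] /= H].
    have [u gu] := gonto x.
    (* The errors in the time and in the parameter of [g] add up in the distance from [S (N q)] to
       [g (ratr r)], so each gets half of [e n]. Approximating [t] from above keeps [ratr q]
       nonnegative. *)
    have e4 : 0 < e n / 2 by rewrite divr_gt0.
    have [q /andP[q1 q2]] := rat_dist_lt t%:num e4.
    have [r /andP[r1 r2]] := rat_dist_lt u e4.
    have tge : 0 <= t%:num by [].
    have NE : (N q)%:num = ratr q by rewrite /= ger0_norm// (le_trans tge).
    have l1 := patrol_unit_speed S (N q) t.
    have l2 := gL u (ratr r).
    rewrite NE ger0_norm in l1; last by lra.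
    rewrite ler0_norm in l2; last by lra.
    exists (q, r) => //=; split; last split.
    - have l3 := metric_triangle (S (N q)) x (g (ratr r)).
      by rewrite Stx in l1; rewrite gu in l2; lra.
    - by rewrite gu in l2; lra.
    - by rewrite NE in_itv /=; apply/andP; split; lra.
  apply: intercepts_approx => // n.
  have [[q r] _ /= [h1 [h2 h3]]] := H n Logic.I.
  rewrite in_itv /= in h3; have := e0 n => en.
  exists (N q); first by rewrite ee /=; apply/andP; split; lra.
  have l3 := metric_triangle (S (N q)) (g (ratr r)) x.
  by rewrite ee; rewrite (metric_sym (g _) x) in l3; lra.
apply: bigcapT_measurable => n; apply: countable_bigcupT_measurable => // -[q r].
have m1 : measurable_fun setT
    (fun u : patrol Q * (npoint Q * R) => u.1 (N q)).
  exact: measurableT_comp (measurable_eval (N q)) measurable_fst.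
have m2 : measurable_fun setT (fun u : patrol Q * (npoint Q * R) => u.2.1).
  exact: measurableT_comp measurable_fst measurable_snd.
have m3 : measurable_fun setT (fun u : patrol Q * (npoint Q * R) => u.2.2).
  exact: measurableT_comp measurable_snd measurable_snd.
have := m1 measurableT _ (measurable_mdist_lt (g (ratr r)) (e n)).
have := m2 measurableT _ (measurable_mdist_lt (g (ratr r)) (e n)).
have := m3 measurableT _
  (measurable_itv `[(N q)%:num - alpha - e n, (N q)%:num + e n]).
rewrite !setTI => h3 h2 h1.
exact: measurableI h1 (measurableI _ _ h2 h3).
Qed.

End intercept_measurable.

(** * Length covered by a unit speed path *)

Section length_of_image.
Context {R : realType} (Q : network R).

(** The potential [f] is the distance to [a] along [e] truncated at [r], and [r] off [e]. By
    [dist_potential] it grows by less than [r] from [chart e a], where it vanishes, to [y]; so [y]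
    lies on [e], where the truncation is not active. *)
Lemma chart_near (e : Defs.arc Q) (a r : R) (y : npoint Q) :
  r <= a <= len e - r -> mdist (chart e a) y < r ->
  exists2 p, y = inr p & (val p).1 = e /\ `|a - (val p).2| <= mdist (chart e a) y.
Proof.
case/andP=> ra ar yr.
have r0 : 0 < r by rewrite (le_lt_trans _ yr)// mdist_ge0.
have l0 := len_gt0 e.
pose G (e' : Defs.arc Q) (s : R) : R := if e' == e then Num.min r `|s - a| else r.
pose f (z : npoint Q) : R := match z with
  | inl w => r
  | inr p => G (val p).1 (val p).2 end.
(* The bounds on [a] make [G e] equal to [r] at both ends of [e], in agreement with the value of [f]
   at the nodes. *)
have fE e' s : 0 <= s <= len e' -> f (chart e' s) = G e' s.
  case/andP=> s0 sl; have [s0'|s0'] := leP s 0.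
    have -> : s = 0 by apply/eqP; rewrite eq_le s0 s0'.
    rewrite chart_tail// /= /G; case: eqP => // _; apply/esym/min_idPl.
    by rewrite sub0r normrN ger0_norm//; lra.
  have [sl'|sl'] := leP (len e') s.
    have -> : s = len e' by apply/eqP; rewrite eq_le sl sl'.
    rewrite chart_head// /= /G; case: eqP => // ->; apply/esym/min_idPl.
    by rewrite ger0_norm//; lra.
  have es : 0 < (e', s).2 < len (e', s).1 by rewrite /= s0' sl'.
  by rewrite (chart_in es).
have fL : forall e b c, 0 <= b <= len e -> 0 <= c <= len e ->
     f (chart e c) - f (chart e b) <= `|b - c|.
  move=> e' b c hb hc; rewrite !fE// /G; case: eqP => // _; last by rewrite subrr.
  have := ler_distD b c a; rewrite (distrC c b).
  by move=> h; apply: min_nonexpansive; rewrite ?subrr// lerBlDr.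
have : f y - f (chart e a) <= mdist (chart e a) y := dist_potential fL _ _.
have ha : 0 <= a <= len e by apply/andP; split; lra.
rewrite fE// /G eqxx subrr normr0 (min_r (ltW r0)) subr0.
case: y yr => [w|[[e' s] p]] yr /=; first by lra.
rewrite /G; case: eqP => [?|_]; last by lra.
subst e'; move=> h; exists (exist _ (e, s) p) => //=; split => //.
by rewrite distrC; move: h; rewrite ge_min => /orP[|//]; lra.
Qed.

(* Cut the time interval into [N] pieces of length [h]; a piece that meets the
   arc [e] at distance at least [r > h] from its ends stays in [e], within
   [h / 2] of the position at the middle of the piece. *)
Lemma length_image_le (f : R -> npoint Q) (a b : R) (B : set (npoint Q)) :
  (forall t u, a <= t <= b -> a <= u <= b -> mdist (f t) (f u) <= `|t - u|) ->
  a < b -> measurable B -> B `<=` f @` `[a, b] ->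
  (length_measure B <= (b - a)%:E)%E.
Proof.
move=> fL ab mB Bsub.
(* [K * r] pays for the two end segments of length [r] of every arc; it vanishes with [r]. *)
pose K : R := 2 * #|Defs.arc Q|%:R.
suff H r : 0 < r -> (length_measure B <= (K * r)%:E + (b - a)%:E)%E.
  apply/lee_addgt0Pr => e e0.
  have K0 : 0 < K + 1 by rewrite ltr_pwDr// mulr_ge0.
  apply: (le_trans (H (e / (K + 1)) (divr_gt0 e0 K0))).
  rewrite addeC leeD2l// lee_fin mulrA ler_pdivrMr// (mulrC e).
  by rewrite ler_pM2r// lerDl.
move=> r0.
(* The successor makes [h < r] strict and keeps [N] positive. *)
pose N := (Num.truncn ((b - a) / r)).+1.
pose h := (b - a) / N%:R.
have N0 : 0 < N%:R :> R by rewrite ltr0n.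
have h0 : 0 < h by rewrite divr_gt0// subr_gt0.
have hr : h < r.
  by rewrite /h ltr_pdivrMr// mulrC -ltr_pdivrMr// truncnS_gt.
have Nh : h * N%:R = b - a by rewrite /h divfK// gt_eqF.
pose m (j : nat) := a + h * (j%:R + 2^-1).
(* The part of [e] that the [j]-th piece can reach, away from the ends of [e]. It is nonempty for at
   most one [e], which gives [sumI]. *)
pose I (e : Defs.arc Q) (j : nat) : set R := match f (m j) with
  | inl _ => set0
  | inr p => if (val p).1 == e
             then `[(val p).2 - h / 2, (val p).2 + h / 2]%classic else set0
  end.
have mI e j : measurable (I e j).
  by rewrite /I; case: (f (m j)) => // p; case: ifP => // _; exact: measurable_itv.
have sumI j : (\sum_(e : Defs.arc Q) lebesgue_measure (I e j) <= h%:E)%E.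
  rewrite /I; case: (f (m j)) => [w|p].
    by rewrite big1 ?lee_fin ?(ltW h0)// => e _; rewrite measure0.
  rewrite (bigD1 (val p).1)//= eqxx big1 => [|e]; last first.
    by rewrite eq_sym => /negbTE ->; rewrite measure0.
  rewrite adde0 lebesgue_measure_itv /= lte_fin ifT; last by lra.
  by rewrite -EFinB lee_fin; lra.
have pieces t : a <= t <= b -> exists2 j, (j < N)%N & `|t - m j| <= h / 2.
  (* At [t = b] the truncated quotient would be [N], so the last piece, of index [N.-1], is taken
     instead. *)
  case/andP=> at_ tb; have [tb'|tb'] := leP b t.
    exists N.-1; first by rewrite /N.
    have NE : N%:R = N.-1%:R + 1 :> R by rewrite natr1.
    have -> : t = b by apply/eqP; rewrite eq_le tb tb'.
    rewrite /m ler_norml; move: Nh; rewrite NE; set x := _%:R => Nh.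
    by apply/andP; split; lra.
  have q0 : 0 <= (t - a) / h by rewrite divr_ge0 ?subr_ge0// ltW.
  exists (Num.truncn ((t - a) / h)).
    rewrite truncn_lt_nat// ltr_pdivrMr//; lra.
  have /andP[] := truncn_itv q0; rewrite -natr1 /m.
  set x := _%:R; rewrite ler_pdivlMr// ltr_pdivrMr// => h1 h2.
  by rewrite ler_norml; apply/andP; split; lra.
have cover e : `]0, len e[%classic `&` chart e @^-1` B `<=`
    (`[0, r] `|` `[len e - r, len e])
      `|` \big[setU/set0]_(j < N) I e j.
  move=> s [/=]; rewrite in_itv /= => /andP[s0 sl] Bs.
  have [sr|sr] := leP s r; first by left; left; rewrite /= in_itv /= (ltW s0).
  have [ls|ls] := leP (len e - r) s; first by left; right; rewrite /= in_itv /= ls ltW.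
  right; rewrite -bigcup_mkord.
  have [t /= + ft] := Bsub _ Bs; rewrite in_itv /= => tab.
  have [j jN tj] := pieces t tab; exists j => //.
  have mab : a <= m j <= b.
    have jN' : (j%:R + 1 : R) <= N%:R by rewrite natr1 ler_nat.
    have j0 : 0 <= j%:R :> R by [].
    have := ler_wpM2l (ltW h0) jN'; have := mulr_ge0 (ltW h0) j0.
    rewrite Nh /m !mulrDr mulr1; set x := _ * _ => ? ?; apply/andP; split; lra.
  have dm : mdist (chart e s) (f (m j)) <= h / 2.
    by rewrite -ft (le_trans (fL _ _ tab mab)).
  have [||p pE [pe ps]] := @chart_near e s r (f (m j)).
  - by rewrite (ltW sr) (ltW ls).
  - by rewrite (le_lt_trans dm)//; lra.
  rewrite /I pE pe eqxx /= in_itv /=.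
  have {}ps := le_trans ps dm; move: ps; rewrite ler_norml => /andP[? ?].
  by apply/andP; split; lra.
rewrite /length_measure.
apply: (@le_trans _ _ (\sum_(e : Defs.arc Q) ((r + r)%:E
   + \sum_(j < N) lebesgue_measure (I e j)))%E).
  apply: lee_sum => e _.
  have mU : measurable (\big[setU/set0]_(j < N) I e j).
    by apply: bigsetU_measurable.
  have mL : measurable (`[0, r] `|` `[len e - r, len e] : set R).
    by apply: measurableU; exact: measurable_itv.
  apply: (@le_trans _ _ (lebesgue_measure
      ((`[0, r] `|` `[len e - r, len e]) `|` \big[setU/set0]_(j < N) I e j))).
    apply: le_measure; rewrite ?inE.
    - apply: measurableI; first exact: measurable_itv.
      by rewrite -[X in measurable X]setTI; exact: measurable_chart.
    - exact: measurableU.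
    - exact: cover.
  have m2 := measureU2 (@lebesgue_measure R) mL mU.
  apply: (le_trans m2); apply: leeD; last first.
    exact: (@Boole_inequality _ _ _ lebesgue_measure (I e) N (fun i _ => mI e i)).
  have m3 := measureU2 (@lebesgue_measure R) (measurable_itv `[0, r])
    (measurable_itv `[len e - r, len e]).
  apply: (le_trans m3).
  have r1 : (lebesgue_measure `[0%R, r]%classic <= r%:E)%E.
    by rewrite lebesgue_measure_itv /= lte_fin r0 -EFinB lee_fin subr0.
  have r2 : (lebesgue_measure `[(len e - r)%R, len e]%classic <= r%:E)%E.
    rewrite lebesgue_measure_itv /= lte_fin ifT; last by lra.
    by rewrite -EFinB lee_fin; lra.
  by rewrite EFinD; exact: leeD r1 r2.
(* Summing over the arcs first counts each time piece only once, for a total of [N] times [h]. *)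
rewrite big_split /= exchange_big /=; apply: leeD.
  rewrite sumEFin sumr_const lee_fin -mulr_natr /K; lra.
apply: (@le_trans _ _ (\sum_(j < N) h%:E)%E); first exact: lee_sum.
by rewrite sumEFin sumr_const card_ord lee_fin -mulr_natr Nh.
Qed.

End length_of_image.

(** * Arcs of offsets on the circle of length [L] *)

Section circle.
Context {R : realType} (L : R) (L_gt0 : 0 < L).

Lemma modr_eq (t : R) (r : R) (n : int) : 0 <= r < L -> t = r + n%:~R * L ->
  modr L t = r.
Proof.
move=> /andP[r0 rL] ->; rewrite /modr.
suff -> : Num.floor ((r + n%:~R * L) / L) = n by rewrite addrK.
apply/floor_def; rewrite intrD ler_pdivlMr// ltr_pdivrMr// mulrDl mul1r.
by apply/andP; split; lra.
Qed.

(* The offsets for which a visit at phase [c] falls in a time window of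
   length [alpha]. *)
Definition hits (alpha c : R) : set R :=
  [set D | 0 <= D < L /\ modr L (c - D) < alpha].

(** The residue of [c - D] is [d - D] for [D <= d] and [d - D + L] beyond. Hence this is the
    circular arc of length [alpha] ending at [d], which is cut in two at [0] when [d < alpha]. *)
Lemma hitsE (alpha c : R) : 0 < alpha <= L ->
  let d := modr L c in
  hits alpha c = if alpha <= d then `]d - alpha, d]%classic
                 else `[0, d] `|` `]d - alpha + L, L[.
Proof.
move=> /andP[a0 aL] d.
have /andP[d0 dL] := modr_itv L_gt0 c; rewrite -/d in d0 dL.
have cE : c = d + (Num.floor (c / L))%:~R * L by rewrite /d /modr subrK.
have m1 D : 0 <= D <= d -> modr L (c - D) = d - D.
  move=> /andP[? ?]; apply: (@modr_eq _ _ (Num.floor (c / L))); last lra.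
  by apply/andP; split; lra.
have m2 D : d < D < L -> modr L (c - D) = d - D + L.
  move=> /andP[? ?]; apply: (@modr_eq _ _ (Num.floor (c / L) - 1)).
    by apply/andP; split; lra.
  by rewrite intrB; lra.
apply/seteqP; split => D.
  case=> /andP[D0 DL]; have [Dd|dD] := leP D d.
    rewrite m1 ?D0// => h; case: ifP => ad; first by rewrite /= in_itv /=; lra.
    by left; rewrite /= in_itv /= D0.
  rewrite m2 ?dD// => h; case: ifP => ad; first by exfalso; lra.
  by right; rewrite /= in_itv /= DL andbT; lra.
case: ifP => ad.
  rewrite /= in_itv /= => /andP[h1 h2]; split; first by apply/andP; split; lra.
  by rewrite m1; [lra|apply/andP; split; lra].
have {}ad : d < alpha by rewrite ltNge ad.
case; rewrite /= in_itv /= => /andP[h1 h2].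
  split; first by apply/andP; split; lra.
  by rewrite m1; [lra|apply/andP; split; lra].
split; first by apply/andP; split; lra.
by rewrite m2; [lra|apply/andP; split; lra].
Qed.

Lemma measurable_hits (alpha c : R) : 0 < alpha <= L ->
  measurable (hits alpha c).
Proof.
move=> aL; rewrite (hitsE _ aL); case: ifP => _; first exact: measurable_itv.
by apply: measurableU; exact: measurable_itv.
Qed.

Lemma lebesgue_hits (alpha c : R) : 0 < alpha <= L ->
  lebesgue_measure (hits alpha c) = alpha%:E.
Proof.
move=> aL; rewrite (hitsE _ aL) /=; set d := modr L c.
have /andP[d0 dL] := modr_itv L_gt0 c; rewrite -/d in d0 dL.
move: aL => /andP[a0 aL]; case: ifP => ad.
  rewrite lebesgue_measure_itv /= lte_fin ifT; last by lra.
  by rewrite -EFinB; congr (_%:E); lra.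
have {}ad : d < alpha by rewrite ltNge ad.
have U := measureU (@lebesgue_measure R) (measurable_itv `[0, d])
  (measurable_itv `]d - alpha + L, L[).
apply: etrans; first apply: U.
  apply/seteqP; split => // x [] /=; rewrite !in_itv /= => /andP[? ?] /andP[? ?].
  by lra.
have U1 : lebesgue_measure `[0, d]%classic = d%:E.
  rewrite lebesgue_measure_itv /= lte_fin; case: ifPn => h.
    by rewrite -EFinB subr0.
  by congr (_%:E); lra.
have U2 : lebesgue_measure `]d - alpha + L, L[%classic = (alpha - d)%:E.
  rewrite lebesgue_measure_itv /= lte_fin ifT; last by lra.
  by rewrite -EFinB; congr (_%:E); lra.
by rewrite [X in (X + _)%E]U1 [X in (_ + X)%E]U2 -EFinD; congr (_%:E); lra.
Qed.

(** For a common offset, the two residues lie in [[0, alpha[] and [c - c'] is their difference plus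
    a multiple of [L]. A zero multiple gives a distance below [alpha]; any other gives one above
    [L - alpha]. *)
Lemma hits_disjoint (alpha c c' : R) : `|c - c'| < L ->
  alpha <= Num.min `|c - c'| (L - `|c - c'|) -> forall tau,
  hits alpha (c - tau) `&` hits alpha (c' - tau) = set0.
Proof.
move=> ccL; rewrite le_min => /andP[h1 h2] tau.
apply/seteqP; split => // D [[_ a1] [_ a2]].
have /andP[b1 _] := modr_itv L_gt0 (c - tau - D).
have /andP[b2 _] := modr_itv L_gt0 (c' - tau - D).
have e1 : c - tau - D =
    modr L (c - tau - D) + (Num.floor ((c - tau - D) / L))%:~R * L.
  by rewrite /modr subrK.
have e2 : c' - tau - D =
    modr L (c' - tau - D) + (Num.floor ((c' - tau - D) / L))%:~R * L.
  by rewrite /modr subrK.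
move: a1 a2 b1 b2 e1 e2; set x := modr _ _; set y := modr _ _.
set m := Num.floor _; set n := Num.floor _ => a1 a2 b1 b2 e1 e2.
have {}e : c - c' = x - y + (m - n)%:~R * L by rewrite intrB; lra.
have [mn|mn|mn] := ltgtP (m - n)%R 0.
- have : (m - n)%:~R * L <= (-1) * L.
    by rewrite ler_pM2r// -[-1](intrN _ 1) ler_int -ltzD1.
  move: h1 h2; case: (ger0P (c - c')); lra.
- have : 1 * L <= (m - n)%:~R * L.
    by rewrite ler_pM2r// -[1]/(1%:~R) ler_int -gtz0_ge1.
  move: h1 h2; case: (ger0P (c - c')); lra.
- rewrite mn mul0r addr0 in e.
  move: h1; rewrite e; case: (ger0P (x - y)); lra.
Qed.

End circle.

(** * Interception probability of the randomized extension *)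

Section phase.
Context {R : realType} (Q : network R) (alpha L : R) (L_gt0 : 0 < L).

Lemma uniform_probE (U : set R) : measurable U ->
  uniform_prob L_gt0 U = (L^-1%:E * lebesgue_measure (U `&` `[0%R, L]))%E.
Proof.
move=> mU; rewrite /uniform_prob integral_uniform_pdf.
rewrite (eq_integral (fun=> (L^-1)%:E)); last first.
  by move=> x; rewrite inE => -[_]; rewrite /= in_itv/= /uniform_pdf subr0 => ->.
by rewrite integral_cst//; apply: measurableI => //; exact: measurable_itv.
Qed.

(** With [r] the residue of [t - tau - D], the time [tau + r] shifted by [D] is congruent to [t]
    modulo [L]; so the shifted patrol is at [x] then, less than [alpha] after [tau]. *)
Lemma hits_intercepts (S : closed_path Q L) (x : npoint Q) (t tau D : R) :
  0 <= tau -> 0 <= t < L -> S t = x -> hits L alpha (t - tau) D ->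
  intercepts alpha (Defs.shift S L_gt0 D) (x, tau).
Proof.
move=> tau0 tL Stx [_]; set r := modr _ _ => ra.
have /andP[r0 _] := modr_itv L_gt0 (t - tau - D); rewrite -/r in r0.
exists (NngNum (addr_ge0 tau0 r0)) => /=; first by apply/andP; split; lra.
rewrite -Stx; congr (S _).
apply: (@modr_eq _ _ L_gt0 _ _ (- Num.floor ((t - tau - D) / L))) => //.
by rewrite intrN /r /modr; lra.
Qed.

Lemma interception_probability_ge (S : closed_path Q L) (k : nat) (x : npoint Q)
    (tau : R) (t : 'I_k -> R) :
  0 < alpha ->
  (forall i, 0 <= t i < L /\ S (t i) = x) ->
  (forall i j, i != j ->
     alpha <= Num.min `|t i - t j| (L - `|t i - t j|)) ->
  (k = 1%N -> alpha <= L) -> 0 <= tau ->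
  measurable [set s : patrol Q | intercepts alpha s (x, tau)] ->
  ((k%:R * alpha / L)%:E <= randomized_extension S L_gt0
     [set s : patrol Q | intercepts alpha s (x, tau)])%E.
Proof.
move=> alpha0 tS tsep k1 tau0 mI.
(* For [k >= 2], separation of two visits gives [2 * alpha <= L]; for [k = 1] it is vacuous, and
   [k1] supplies the bound. *)
have aL (i : 'I_k) : 0 < alpha <= L.
  rewrite alpha0 /=; case: k t tS tsep k1 i => [|[|k]] t tS tsep k1 i.
  - by case: i.
  - exact: k1.
  - have /tsep : (ord0 : 'I_k.+2) != ord_max by [].
    by rewrite le_min => /andP[? ?]; lra.
rewrite /randomized_extension /distribution /= /pushforward.
set E := (X in uniform_prob _ X).
have mE : measurable E.
  by rewrite /E -[X in measurable X]setTI; exact: measurable_shift.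
(* The offset has density [L^-1], so it suffices to find length [k * alpha] of good offsets; the
   disjoint sets [F i], one per visit, provide it. *)
suff H : ((k%:R * alpha)%:E <= lebesgue_measure (E `&` `[0%R, L]))%E.
  rewrite uniform_probE// mulrC EFinM lee_wpmul2l// lee_fin invr_ge0.
  exact: ltW.
pose F i := hits L alpha (t i - tau).
have mF i : measurable (F i) by apply: measurable_hits => //; exact: aL.
have tF : trivIset setT F.
  apply/trivIsetP => i j _ _ ij; apply: hits_disjoint => //; last exact: tsep.
  exact: abs_sub_lt (tS i).1 (tS j).1.
have -> : (k%:R * alpha)%:E = lebesgue_measure (\big[setU/set0]_(i < k) F i).
  have := measure_bigsetU_ord (@lebesgue_measure R) xpredT mF tF.
  move=> ->; rewrite (eq_bigr (fun=> alpha%:E)) => [|i _]; last first.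
    exact: (lebesgue_hits L_gt0 _ (aL i)).
  by rewrite sumEFin sumr_const card_ord mulr_natl.
apply: le_measure; rewrite ?inE.
- by apply: bigsetU_measurable => i _; exact: mF.
- by apply: measurableI => //; exact: measurable_itv.
- apply: (big_ind (fun A => A `<=` E `&` `[0, L])).
  + exact: sub0set.
  + by move=> A B AE BE; rewrite subUset.
  + move=> i _ D FD; have [ti Sti] := tS i.
    split; first exact: (hits_intercepts tau0 ti Sti FD).
    by case: FD => /andP[D0 DL] _; rewrite /= in_itv /= D0 ltW.
Qed.

End phase.

(** * Payoffs as iterated integrals, guarantees and weak duality *)

Section minimax.
Context {R : realType} (Q : network R) (alpha : R).
Context (mI : measurable
  [set u : patrol Q * (npoint Q * R) | intercepts alpha u.1 u.2]).

Lemma measurable_intercepts_attack (a : npoint Q * R) :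
  measurable [set s : patrol Q | intercepts alpha s a].
Proof.
have := measurable_ysection a mI.
by congr measurable; apply/seteqP; split => s; rewrite /ysection /= inE.
Qed.

Lemma measurable_intercepts_patrol (s : patrol Q) :
  measurable [set a : npoint Q * R | intercepts alpha s a].
Proof.
have := measurable_xsection s mI.
by congr measurable; apply/seteqP; split => a; rewrite /xsection /= inE.
Qed.

Lemma payoff_patrolE (P : probability (patrol Q) R)
    (A : probability (npoint Q * R)%type R) :
  payoff alpha P A = (\int[P]_s A [set a | intercepts alpha s a])%E.
Proof.
apply: eq_integral => s _ /=; congr (A _).
by apply/seteqP; split => a; rewrite /xsection /= inE.
Qed.

(** The product measure is built by integrating over patrols. The reverse construction [\x^] has the
    same values on rectangles, hence is the same measure by uniqueness. *)
Lemma payoff_attackE (P : probability (patrol Q) R)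
    (A : probability (npoint Q * R)%type R) :
  payoff alpha P A = (\int[A]_a P [set s | intercepts alpha s a])%E.
Proof.
rewrite /payoff (@product_measure_unique _ _ _ _ _ _ _ (P \x^ A)%E)//.
  apply: eq_integral => a _ /=; congr (P _).
  by apply/seteqP; split => s; rewrite /ysection /= inE.
by move=> U V mU mV /=; rewrite product_measure2E.
Qed.

Lemma measurable_payoff_attack (P : probability (patrol Q) R) :
  measurable_fun [set: npoint Q * R]
    (fun a => P [set s | intercepts alpha s a]).
Proof.
have := @measurable_fun_ysection _ _ _ _ _ P _ mI.
congr measurable_fun; apply/funext => a /=; congr (P _).
by apply/seteqP; split => s; rewrite /ysection /= inE.
Qed.

Lemma measurable_payoff_patrol (A : probability (npoint Q * R)%type R) :
  measurable_fun [set: patrol Q]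
    (fun s => A [set a | intercepts alpha s a]).
Proof.
have := @measurable_fun_xsection _ _ _ _ _ A _ mI.
congr measurable_fun; apply/funext => s /=; congr (A _).
by apply/seteqP; split => a; rewrite /xsection /= inE.
Qed.

(** The pointwise bound is available for [tau >= 0] only, so the integral over attacks is first
    restricted to that set [D], which has [A]-mass [1]; the part dropped is nonnegative. *)
Lemma patroller_guarantee_ge (P : probability (patrol Q) R) (v : R) : 0 <= v ->
  (forall x tau, 0 <= tau ->
     (v%:E <= P [set s | intercepts alpha s (x, tau)])%E) ->
  (v%:E <= patroller_guarantee alpha P)%E.
Proof.
move=> v0 Pv; apply: le_ereal_inf_tmp => _ [A mixA <-].
move: (mixA); rewrite /mixed_attacks /=; set D := (X in A X) => AD.
have mD : measurable D by apply: measurableX => //; exact: measurable_itv.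
rewrite payoff_attackE.
have mP := measurable_payoff_attack P.
have h1 : (\int[A]_(a in D)
    P [set s | intercepts alpha s a] <=
    \int[A]_a P [set s | intercepts alpha s a])%E.
  exact: ge0_subset_integral.
have h2 : (\int[A]_(a in D) (cst v%:E) a <=
    \int[A]_(a in D)
    P [set s | intercepts alpha s a])%E.
  apply: ge0_le_integral => //.
  - by apply: measurable_funS mP.
  - by move=> [x tau] [_ /=]; rewrite in_itv /= andbT => tau0; exact: Pv.
apply: le_trans h1; apply: le_trans h2.
by rewrite integral_cst// [X in (_ * X)%E]AD mule1.
Qed.

Lemma attacker_guarantee_le (A : probability (npoint Q * R)%type R) (v : R) :
  0 <= v ->
  (forall s : patrol Q, (A [set a | intercepts alpha s a] <= v%:E)%E) ->
  (attacker_guarantee alpha A <= v%:E)%E.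
Proof.
move=> v0 Av; apply: ge_ereal_sup => _ [P _ <-].
rewrite payoff_patrolE.
apply: (@le_trans _ _ (\int[P]_s (cst v%:E) s)%E).
  apply: ge0_le_integral => //; exact: measurable_payoff_patrol.
by rewrite integral_cst// [X in (_ * X)%E]probability_setT mule1.
Qed.

(** Weak duality: [payoff alpha P A] lies between the guarantee of [P] and that of [A]. *)
Lemma lower_le_upper_value : (lower_value Q alpha <= upper_value Q alpha)%E.
Proof.
apply: ge_ereal_sup => _ [P _ <-]; apply: le_ereal_inf_tmp => _ [A mixA <-].
apply: (@le_trans _ _ (payoff alpha P A)).
  by apply: ereal_inf_lbound; exists A.
by apply: ereal_sup_ubound; exists P.
Qed.

End minimax.

(** * Uniform attack strategies *)

Section uniform.
Context {R : realType} (Q : network R).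

(** There are finitely many arcs, each of finite length. Finiteness keeps [mnormalize] away from its
    fallback. *)
Lemma length_measure_setT_lty : (length_measure [set: npoint Q] < +oo)%E.
Proof.
rewrite /length_measure; apply: lte_sum_pinfty => e _.
rewrite preimage_setT setIT lebesgue_measure_itv /=; case: ifPn => // _.
by rewrite -EFinB ltry.
Qed.

Lemma mixed_uniform_attack (M : R) : 0 <= M -> mixed_attacks (uniform_attack Q M).
Proof.
move=> M0; rewrite /mixed_attacks /= /uniform_attack.
rewrite product_measure1E//.
rewrite [X in (X * _)%E]probability_setT mul1e [LHS]diracE mem_set//=.
by rewrite in_itv /= M0.
Qed.

(** The attack time is a Dirac mass at [M], so only the section of [B] at [M] counts; since the
    total length is positive and finite, [mnormalize] really divides by it. *)
Lemma uniform_attackE (M : R) (B : set (npoint Q * R)) :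
  measurable B -> 0 < total_length Q ->
  (uniform_attack Q M B =
   length_measure [set x | B (x, M)] * (total_length Q)^-1%:E)%E.
Proof.
move=> mB mu0; rewrite /uniform_attack.
have mBM : measurable [set x | B (x, M)].
  have := measurable_ysection M mB.
  by congr measurable; apply/seteqP; split => x; rewrite /ysection /= inE.
pose nu := mnormalize (@length_measure R Q) \d_(point : npoint Q).
apply: (@etrans _ _ (nu [set x | B (x, M)])).
  transitivity (\int[nu]_x (\1_[set x | B (x, M)] x)%:E)%E.
    apply: eq_integral => x _ /=; rewrite diracE indicE /xsection.
    by congr ((nat_of_bool _)%:R%:E); apply/asboolP/asboolP; rewrite /= inE.
  by rewrite integral_indic// setIT.
have mufin := length_measure_setT_lty.
rewrite /nu /mnormalize ifF//.
apply/negbTE; rewrite negb_or (lt_eqF mufin) andbT.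
apply/eqP => mu00; move: mu0; rewrite /total_length mu00 ltxx; exact.
Qed.

(** The points intercepted by [s] lie in the image of [[M, M + alpha]], whose measurable subsets
    have length at most [alpha] by [length_image_le]. *)
Lemma uniform_attack_intercepts_le (alpha M : R) (s : patrol Q) :
  0 < alpha -> 0 <= M -> 0 < total_length Q ->
  measurable [set a : npoint Q * R | intercepts alpha s a] ->
  (uniform_attack Q M [set a | intercepts alpha s a] <=
   (alpha / total_length Q)%:E)%E.
Proof.
move=> alpha0 M0 mu0 mA; rewrite uniform_attackE//.
rewrite EFinM lee_wpmul2r//; first by rewrite lee_fin invr_ge0 ltW.
have -> : alpha%:E = (M + alpha - M)%:E by congr (_%:E); lra.
apply: (@length_image_le _ _ (fun t => s (abs_nng t))).
- move=> t u _ _; apply: (le_trans (patrol_unit_speed s _ _)).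
  exact: ler_dist_dist.
- by rewrite ltrDl.
- have := measurable_ysection M mA.
  by congr measurable; apply/seteqP; split => x; rewrite /ysection /= inE.
- move=> x [t /= tM stx]; exists t%:num; first by rewrite /= in_itv.
  by rewrite -stx; congr (s _); apply/val_inj; rewrite /= ger0_norm.
Qed.

End uniform.

Theorem theorem2 (R : realType) (Q : network R) (alpha : R)
    (alpha_gt0 : 0 < alpha) (L : R) (L_gt0 : 0 < L) (S : closed_path Q L)
    (S_onto : forall x : npoint Q, exists2 t : R, 0 <= t <= L & S t = x)
    (k : nat)
    (S_visits : forall x : npoint Q, exists t : 'I_k -> R,
       (forall i, 0 <= t i < L /\ S (t i) = x) /\
       (forall i j, i != j ->
          alpha <= Num.min `|t i - t j| (L - `|t i - t j|)))
    (alpha_le_L : k = 1%N -> alpha <= L) :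
  (forall (x : npoint Q) (tau : R), 0 <= tau ->
     ((k%:R * alpha / L)%:E <=
      randomized_extension S L_gt0
        [set s : patrol Q | intercepts alpha s (x, tau)])%E) /\
  (L = k%:R * total_length Q ->
   [/\ optimal_patrol alpha (randomized_extension S L_gt0),
       (forall M : R, 0 <= M -> optimal_attack alpha (uniform_attack Q M)) &
       is_value Q alpha (alpha / total_length Q)%:E]).
Proof.
have mI : measurable
    [set u : patrol Q * (npoint Q * R) | intercepts alpha u.1 u.2].
  (* The periodic extension of [S] serves as the 1-Lipschitz surjection from the line onto the
     network. *)
  apply: (@measurable_intercepts _ _ (fun u => S (modr L u))).
  - exact: ltW.
  - exact: periodic_unit_speed.
  - move=> x; have [t /andP[t0 tL] <-] := S_onto x.
    move: tL; rewrite le_eqVlt => /orP[/eqP ->|tL].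
      (* The time [L] has residue [0], so a visit at [L] is replaced by one at [0], the path being
         closed. *)
      exists 0; rewrite -(path_closed S); congr (S _).
      by apply: (@modr_eq _ _ L_gt0 _ _ 0); rewrite ?lexx ?mul0r ?addr0.
    exists t; congr (S _).
    by apply: (@modr_eq _ _ L_gt0 _ _ 0); rewrite ?t0 ?mul0r ?addr0.
have guarantee (x : npoint Q) (tau : R) : 0 <= tau ->
    ((k%:R * alpha / L)%:E <= randomized_extension S L_gt0
      [set s : patrol Q | intercepts alpha s (x, tau)])%E.
  move=> tau0; have [t [tS tsep]] := S_visits x.
  apply: (interception_probability_ge L_gt0 alpha_gt0 tS tsep) => //.
  exact: measurable_intercepts_attack.
split => // LE.
set mu := total_length Q in LE *.
(* [L = k * mu] is positive, which excludes [k = 0] and forces [mu > 0]; in particular the network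
   has an arc. *)
have mu0 : 0 < mu.
  by have := L_gt0; rewrite LE; case: (k) => [|n]; rewrite ?mul0r ?ltxx// pmulr_rgt0.
have v0 : 0 <= alpha / mu by rewrite divr_ge0// ltW.
have k0 : k%:R != 0 :> R.
  by apply/eqP => k00; have := L_gt0; rewrite LE k00 mul0r ltxx.
have vE : k%:R * alpha / L = alpha / mu by rewrite LE -mulf_div divff// mul1r.
have Pv : ((alpha / mu)%:E <=
    patroller_guarantee alpha (randomized_extension S L_gt0))%E.
  by apply: patroller_guarantee_ge => // x tau tau0; rewrite -vE; exact: guarantee.
have Av M : 0 <= M ->
    (attacker_guarantee alpha (uniform_attack Q M) <= (alpha / mu)%:E)%E.
  move=> M0; apply: attacker_guarantee_le => // s.
  apply: uniform_attack_intercepts_le => //.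
  exact: measurable_intercepts_patrol.
have Pl : (patroller_guarantee alpha (randomized_extension S L_gt0) <=
    lower_value Q alpha)%E.
  by apply: ereal_sup_ubound; exists (randomized_extension S L_gt0).
have uA M : 0 <= M ->
    (upper_value Q alpha <= attacker_guarantee alpha (uniform_attack Q M))%E.
  move=> M0; apply: ereal_inf_lbound; exists (uniform_attack Q M) => //.
  exact: mixed_uniform_attack.
(* The chain from [alpha / mu] through the patrol's guarantee, both values and the attacker's
   guarantee (with [M = 0]) back to [alpha / mu] closes up, so all are equal. *)
have lu := lower_le_upper_value Q alpha.
have uv := le_trans (uA 0 (lexx _)) (Av 0 (lexx _)).
have vl := le_trans Pv Pl.
have lE : lower_value Q alpha = (alpha / mu)%:E.
  by apply/eqP; rewrite eq_le vl andbT (le_trans lu).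
have uE : upper_value Q alpha = (alpha / mu)%:E.
  by apply/eqP; rewrite eq_le uv (le_trans vl).
split => //.
- by rewrite /optimal_patrol; apply/eqP; rewrite eq_le Pl lE.
- move=> M M0; split; first exact: mixed_uniform_attack.
  by apply/eqP; rewrite eq_le uA// uE Av.
Qed.
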